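(* Let $\varepsilon>0$. Let $\omega$ be the period-doubling sequence and let $\mu$ be the unique invariant measure of the period-doubling subshift. Then the limit $\lim_{n\to\infty}\mathrm{C}(\omega,n,\varepsilon)$ exists and equals the correlation integral $\mathrm{c}(\mu,\varepsilon)$, and $$\mathrm{c}(\mu,\varepsilon)=\lim_{n\to\infty}\mathrm{C}(\omega,n,\varepsilon)=\begin{cases}1 & \text{if } m_\varepsilon=0;\\ 5/9 & \text{if } m_\varepsilon=1;\\ (3\cdot 2^{k+1}-4q)/\left((3\cdot 2^k)^2\right) & \text{if } m_\varepsilon\ge 2\text{ and } q<2^{k-1};\\ (5\cdot 2^k-2q)/\left((3\cdot 2^k)^2\right) & \text{if } m_\varepsilon\ge 2\text{ and } q\ge 2^{k-1};\end{cases}$$ where (for $m_\varepsilon\geq 1$) $k\ge 0$ and $0\le q<2^k$ are the integers such that $m_\varepsilon=2^k+q$.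
   Context: The period-doubling sequence $\omega=\omega_1\omega_2\ldots=0100\,0101\,0100\,0100\ldots$ is the unique fixed point in $\{0,1\}^{\mathbb{N}}$ ($\mathbb{N}=\{1,2,\dots\}$) of the substitution $0\mapsto 01$, $1\mapsto 00$; equivalently, $\omega_i=k_i\bmod 2$, where $k_i$ is the largest integer such that $2^{k_i}$ divides $i$. On $\{0,1\}^{\mathbb{N}}$ use the metric $\rho(\alpha,\beta)=0$ if $\alpha=\beta$ and $\rho(\alpha,\beta)=2^{-k+1}$ with $k=\min\{i:\alpha_i\ne\beta_i\}$ if $\alpha\neq\beta$, and the shift $\sigma(\alpha_1\alpha_2\alpha_3\ldots)=\alpha_2\alpha_3\ldots$. The period-doubling subshift is $(X,\sigma)$, where $X$ is the closure of $\{\sigma^n(\omega):n\ge0\}$; it is strictly ergodic, so it has a unique $\sigma$-invariant Borel probability measure $\mu$. The correlation integral is $\mathrm{c}(\mu,\varepsilon)=(\mu\times\mu)\{(x,y)\in X\times X:\rho(x,y)\le\varepsilon\}$. The correlation sum is $\mathrm{C}(x,n,\varepsilon)=\frac{1}{n^2}\#\{(i,j):0\le i,j<n,\ \rho(\sigma^i(x),\sigma^j(x))\le\varepsilon\}$ for $x\in X$, $n\in\mathbb{N}$. For $\varepsilon>0$: $m_\varepsilon=0$ if $\varepsilon\ge1$; otherwise $m_\varepsilon$ is the unique positive integer with $2^{-m_\varepsilon}\le\varepsilon<2^{-m_\varepsilon+1}$. *)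

(* Defs.v *)
From HB Require Import structures.
From mathcomp Require Import all_boot all_order all_algebra.
From mathcomp Require Import all_classical all_reals all_analysis.

Set Implicit Arguments.
Unset Strict Implicit.
Unset Printing Implicit Defensive.

Import Order.TTheory GRing.Theory Num.Theory.
Import numFieldNormedType.Exports.

Local Open Scope classical_set_scope.
Local Open Scope ring_scope.

(* The space {0,1}^N, with 0 = false and 1 = true; sequences are indexed from
   0, so that [x i] is the term usually written x_(i+1). The parameter R only
   serves to fix the field in which the metric of [binseq R] takes its values. *)
Definition binseq (R : realType) : Type := nat -> bool.

HB.instance Definition _ (R : realType) :=
  Pointed.copy (binseq R) (nat -> bool).

Section metric.
Context {R : realType}.
Implicit Types x y z : binseq R.

(* If j is the least 0-based index with x j != y j, then the least 1-based
   index is k = j + 1, and 2^(-k+1) = 2^(-j). *)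
Definition rho x y : R :=
  match pselect (exists i, x i != y i) with
  | left neq_xy => 2 ^- ex_minn neq_xy
  | right _ => 0
  end.

Lemma rho_le x y n :
  (rho x y <= 2 ^- n) <-> (forall i, (i < n)%N -> x i = y i).
Proof.
rewrite /rho; case: pselect => [h|h]; last first.
  split=> [_ i _|_]; last by rewrite invr_ge0 exprn_ge0.
  by apply/eqP/negP => /negP xyi; apply: h; exists i.
case: ex_minnP => j xyj minj; rewrite lef_pV2 ?posrE ?exprn_gt0//.
rewrite ler_eXn2l ?ltr1n//; split=> [nj i ilt|H].
  apply/eqP/negP => /negP /minj; rewrite leqNgt => /negP; apply.
  exact: leq_trans ilt nj.
by rewrite leqNgt; apply/negP => /H xy; move: xyj; rewrite xy eqxx.
Qed.

Lemma rho_val x y : rho x y = 0 \/ exists n, rho x y = 2 ^- n.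
Proof.
by rewrite /rho; case: pselect => [h|h]; [right; eexists|left].
Qed.

Lemma rho_ge0 x y : 0 <= rho x y.
Proof.
by have [->//|[n ->]] := rho_val x y; rewrite invr_ge0 exprn_ge0.
Qed.

Lemma rhoxx x : rho x x = 0.
Proof. by rewrite /rho; case: pselect => // h; have [i /eqP] := h. Qed.

Lemma rho_eq0 x y : rho x y = 0 -> x = y.
Proof.
move=> xy0; apply/funext => i; have /rho_le : rho x y <= 2 ^- i.+1.
  by rewrite xy0 invr_ge0 exprn_ge0.
exact.
Qed.

Lemma rho_sym x y : rho x y = rho y x.
Proof.
have le_rho u v : rho u v <= rho v u.
  have [vu0|[n vun]] := rho_val v u; first by rewrite (rho_eq0 vu0) rhoxx.
  rewrite vun; apply/rho_le => i ilt; apply/esym.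
  by apply: (rho_le v u n).1 ilt; rewrite vun.
by apply/eqP; rewrite eq_le !le_rho.
Qed.

Lemma rho_ultra y x z : rho x z <= Num.max (rho x y) (rho y z).
Proof.
have xyM : rho x y <= Num.max (rho x y) (rho y z) by rewrite le_max lexx.
have yzM : rho y z <= Num.max (rho x y) (rho y z) by rewrite le_max lexx orbT.
have [e0|[n en]] : Num.max (rho x y) (rho y z) = 0 \/
    exists n, Num.max (rho x y) (rho y z) = 2 ^- n.
  by rewrite /Num.max; case: ifP => _; exact: rho_val.
- have xy : x = y.
    by apply: rho_eq0; apply/eqP; rewrite eq_le rho_ge0 andbT -e0.
  by rewrite {1}xy.
- rewrite en; apply/rho_le => i ilt; rewrite en in xyM yzM.
  by rewrite ((rho_le x y n).1 xyM)// ((rho_le y z n).1 yzM).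
Qed.

Lemma rho_triangle y x z : rho x z <= rho x y + rho y z.
Proof.
apply: le_trans (rho_ultra y x z) _.
by rewrite ge_max lerDl lerDr !rho_ge0.
Qed.

End metric.

HB.instance Definition _ (R : realType) :=
  @isMetric.Build R (binseq R) rho rhoxx rho_eq0 rho_sym rho_triangle.

Definition borel_binseq (R : realType) :=
  g_sigma_algebraType (@open (binseq R)).

Section period_doubling.
Context {R : realType}.

Definition shift (x : binseq R) : binseq R := fun i => x i.+1.

(* The substitution 0 |-> 01, 1 |-> 00. *)
Definition pd_subst (x : binseq R) : binseq R :=
  fun i => if odd i then ~~ x i./2 else false.

Definition pd_seq : binseq R := fun i => odd (logn 2 i.+1).

Lemma pd_seq_fixed : pd_subst pd_seq = pd_seq.
Proof.
apply/funext => i; rewrite /pd_subst /pd_seq.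
have [oi|/negbTE ei] := boolP (odd i); last first.
  have /logn_coprime -> // : coprime 2 i.+1 by rewrite coprime2n /= ei.
have -> : i.+1 = (2 * i./2.+1)%N.
  by rewrite -[in LHS](odd_double_half i) oi mul2n doubleS.
by rewrite lognM//.
Qed.

Lemma pd_seq_unique x : pd_subst x = x -> x = pd_seq.
Proof.
move=> fx; apply/funext; elim/ltn_ind => i IH.
rewrite -fx -pd_seq_fixed /pd_subst; case: ifP => // oi.
rewrite IH //; case: i oi {IH} => // i _.
by rewrite -divn2 ltn_Pdiv.
Qed.

Definition pd_subshift : set (binseq R) :=
  closure (range (fun n : nat => iter n shift pd_seq)).

(* A measure on the subshift X is a measure on {0,1}^N carried by X. *)
Definition pd_invariant (mu : probability (borel_binseq R) R) : Prop :=
  mu pd_subshift = 1%E /\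
  forall A : set (borel_binseq R), measurable A -> mu (shift @^-1` A) = mu A.

Definition corr_int (mu : probability (borel_binseq R) R) (eps : R) : R :=
  fine ((mu \x mu)%E
    [set xy | [/\ pd_subshift xy.1, pd_subshift xy.2 & rho xy.1 xy.2 <= eps]]).

Definition corr_sum (x : binseq R) (n : nat) (eps : R) : R :=
  #|[set ij : 'I_n * 'I_n |
      rho (iter ij.1 shift x) (iter ij.2 shift x) <= eps]%SET|%:R / n%:R ^+ 2.

Definition m_eps (eps : R) : nat :=
  if 1 <= eps then 0%N
  else xget 0%N [set m | (0 < m)%N /\ 2 ^- m <= eps < 2 ^- m.-1].

Lemma m_epsP (eps : R) m : 0 < eps < 1 ->
  m_eps eps = m <-> (0 < m)%N /\ 2 ^- m <= eps < 2 ^- m.-1.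
Proof.
move=> /andP[eps0 eps1]; rewrite /m_eps leNgt eps1 /=.
set P := [set m | _].
have P_inj a b : P a -> P b -> (a <= b)%N.
  move=> [a0 /andP[_ ha]] [b0 /andP[hb _]]; have := le_lt_trans hb ha.
  rewrite ltf_pV2 ?posrE ?exprn_gt0// ltr_eXn2l ?ltr1n//.
  by rewrite prednK.
have exP : exists a, P a.
  have ex : exists a, 2 ^- a <= eps.
    have [a ha] : exists a : nat, eps^-1 < a%:R.
      exists (Num.bound eps^-1); apply: archi_boundP.
      by rewrite invr_ge0 ltW.
    exists a; rewrite -[leRHS]invrK lef_pV2 ?posrE ?exprn_gt0 ?invr_gt0//.
    by rewrite (le_trans (ltW ha))// -natrX ler_nat ltnW// ltn_expl.
  case: (ex_minnP ex) => a ha mina.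
  have a0 : (0 < a)%N.
    case: a ha {mina} => //; rewrite expr0 invr1 => /le_lt_trans /(_ eps1).
    by rewrite ltxx.
  exists a; split => //; rewrite ha ltNge/=; apply/negP => /mina.
  by case: a a0 {ha mina} => //= a _; rewrite ltnn.
have Pg : P (xget 0%N P) by have [a Pa] := exP; exact: (xgetI 0%N Pa).
split=> [<-//|Pm]; apply/eqP; rewrite eqn_leq.
by rewrite (P_inj _ _ Pg Pm) (P_inj _ _ Pm Pg).
Qed.

End period_doubling.

Arguments pd_seq {R}.
Arguments pd_subshift {R}.

(* Main.v *)
Require Import Defs.
From mathcomp Require Import all_boot all_order all_algebra.
From mathcomp Require Import all_classical all_reals all_analysis.
From mathcomp Require Import measurable_realfun zify ring lra.

Set Implicit Arguments.
Unset Strict Implicit.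
Unset Printing Implicit Defensive.

Import Order.TTheory GRing.Theory Num.Theory.
Import numFieldNormedType.Exports.

Local Open Scope classical_set_scope.
Local Open Scope ring_scope.

(** Put m = [m_eps eps]. Since the metric takes only the values 0 and 2^-n,
    rho x y <= eps means that x and y have the same first m letters
    ([rho_word]). So the correlation sum and the correlation integral are both
    sums over the words w of length m of the square of a frequency of w: the
    frequency along the orbit of the period-doubling sequence omega for the
    former ([pairs_visits]), the measure of the cylinder of w for the latter
    ([corr_intE]).

    These frequencies agree in the limit. The sequence omega is Toeplitz:
    outside the positions i with i + 1 divisible by 2^P it is 2^P-periodic
    ([pd_toeplitz]). Hence the numbers of occurrences of w in two windows of
    length 2^P differ by an amount bounded in terms of m alone
    ([visits_block]), wherever the windows lie. The words of a point of the
    subshift are words of omega, so integrating the number of occurrences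
    against an invariant mu gives
    |visits - 2^P mu[w]| <= 2m for every window of length 2^P
    ([visits_window_dist]), and then visits / n tends to mu[w]
    ([visits_cvg]).

    Write c(m) for the common limit ([cyl_corr]). The substitution gives a
    recurrence: two even starting points 2i, 2j agree on m letters iff i, j
    agree on floor(m/2) letters, two odd ones iff i, j agree on ceil(m/2)
    letters, and starting points of opposite parity never agree on 3 letters,
    because 11 does not occur in omega. Counting pairs below 2n and
    letting n go to infinity,
      c(m) = (c(floor(m/2)) + c(ceil(m/2))) / 4   for m >= 3
    ([cyl_corr_halves]), while for m = 1, 2 the pairs of opposite parity
    contribute through the density 1/3 of the letter 1, which gives
    c(1) = 5/9 and c(2) = 1/3. By induction on k >= 1, the solution of the
    recurrence is affine in m on each half of the range from 2^k to 2^(k+1),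
    the pieces agreeing at their common ends; this is the stated formula
    ([halving_formula]). *)

(* Unqualified, the name denotes the translation of a normed space. *)
Local Notation shift := Defs.shift.

(** * Words and their occurrences *)

Section words.
Context {R : realType}.
Implicit Types x y : binseq R.

Lemma iter_shiftE n x i : iter n shift x i = x (n + i)%N.
Proof. by elim: n i => [//|n IH] i; rewrite iterS /shift IH addnS. Qed.

Definition word (m : nat) x : m.-tuple bool := [tuple x i | i < m].

Lemma wordP m x y : reflect (forall i, (i < m)%N -> x i = y i) (word m x == word m y).
Proof.
apply: (iffP eqP) => [e i im|e].
  by have /(congr1 (fun w => tnth w (Ordinal im))) := e; rewrite !tnth_mktuple.
by apply: eq_from_tnth => i; rewrite !tnth_mktuple; exact: e.
Qed.

Definition visits m (w : m.-tuple bool) x (n : nat) : nat :=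
  (\sum_(0 <= i < n) (word m (iter i shift x) == w))%N.

Definition pairs m (x : binseq R) (n : nat) : nat :=
  (\sum_(0 <= i < n) \sum_(0 <= j < n)
     (word m (iter i shift x) == word m (iter j shift x)))%N.

Lemma visitsD m (w : m.-tuple bool) x a b :
  visits w x (a + b) = (visits w x a + visits w (iter a shift x) b)%N.
Proof.
rewrite /visits (big_cat_nat (n := a))//= ?leq_addr//; congr addn.
rewrite -{1}(add0n a) big_addn addKn; apply: eq_bigr => i _.
by rewrite -iterD.
Qed.

Lemma visits_le m (w : m.-tuple bool) x n : (visits w x n <= n)%N.
Proof.
rewrite /visits -[leqRHS]subn0 -[leqRHS]muln1 -sum_nat_const_nat.
by apply: leq_sum => i _; exact: leq_b1.
Qed.

(** Sorting the pairs (i, j) by the common word read at i and j turns the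
    count of agreeing pairs into a sum of squares. *)
Lemma pairs_visits m x n : pairs m x n = (\sum_(w : m.-tuple bool) visits w x n ^ 2)%N.
Proof.
under eq_bigr => w _ do rewrite -mulnn /visits big_distrlr /=.
rewrite exchange_big /pairs; apply: eq_bigr => i _ /=.
rewrite exchange_big /=; apply: eq_bigr => j _ /=.
rewrite (bigD1 (word m (iter i shift x)))//= big1 ?addn0.
  by rewrite eqxx mul1n eq_sym.
by move=> w /negbTE; rewrite eq_sym => ->.
Qed.

Lemma sum_nat_even_odd n (F : nat -> nat) :
  (\sum_(0 <= i < n.*2) F i = \sum_(0 <= i < n) (F i.*2 + F i.*2.+1))%N.
Proof.
elim: n => [|n IH]; first by rewrite !big_nil.
by rewrite doubleS !big_nat_recr//= IH addnA.
Qed.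

(** What is lost at one end when the window slides by one is regained at the
    other. *)
Lemma sum_periodic N (F : nat -> nat) j : (forall i, F (i + N) = F i) ->
  (\sum_(j <= i < j + N) F i = \sum_(0 <= i < N) F i)%N.
Proof.
move=> FN; elim: j => [|j IH]; first by rewrite add0n.
have [->|N0] := posnP N; first by rewrite !addn0 !big_geq.
have jN : (j < j + N)%N by rewrite -addn1 leq_add2l.
by rewrite -IH (big_ltn jN) addSn big_nat_recr //= FN addnC.
Qed.

End words.

(** * The period-doubling sequence: Toeplitz structure and desubstitution *)

Section pd_word.
Context {R : realType}.
Notation pd := (@pd_seq R).

Lemma pd_even i : pd i.*2 = false.
Proof. by rewrite -pd_seq_fixed /pd_subst odd_double. Qed.

Lemma pd_odd i : pd i.*2.+1 = ~~ pd i.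
Proof. by rewrite -[in LHS]pd_seq_fixed /pd_subst /= odd_double /= uphalf_double. Qed.

(** The number q 2^P + r + 1 has the same 2-adic valuation as r + 1 when
    0 < r + 1 < 2^P. The induction on P reads this off the fixed-point equation. *)
Lemma pd_toeplitz P q r : (r.+1 < 2 ^ P)%N -> pd (q * 2 ^ P + r)%N = pd r.
Proof.
elim: P r => [|P IH] r; first by rewrite expn0.
rewrite expnS mul2n -doubleMr.
case: (odd r) (odd_double_half r) => /= <-.
  by rewrite add1n addnS -doubleD !pd_odd => h; rewrite IH//; move: h; rewrite -doubleS ltn_double.
by rewrite add0n -doubleD !pd_even.
Qed.

Lemma word_toeplitz m P i : (i %% 2 ^ P + m < 2 ^ P)%N ->
  word m (iter i shift pd) = word m (iter (i %% 2 ^ P) shift pd).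
Proof.
move=> h; apply/eqP/wordP => t tm; rewrite !iter_shiftE.
rewrite [in LHS](divn_eq i (2 ^ P)) -addnA pd_toeplitz//; lia.
Qed.

(** Replacing each position of the window by its residue mod 2^P changes the
    word read there for at most m residues, those whose word reaches the last
    position of its block; a window of length 2^P meets each residue once. *)
Lemma visits_block m (w : m.-tuple bool) P j :
  (visits w (iter j shift pd) (2 ^ P) <= visits w pd (2 ^ P) + m)%N /\
  (visits w pd (2 ^ P) <= visits w (iter j shift pd) (2 ^ P) + m)%N.
Proof.
set N := (2 ^ P)%N.
have N0 : (0 < N)%N by rewrite expn_gt0.
pose g i : nat := word m (iter i shift pd) == w.
(* b marks the positions whose word may depend on the block. *)
pose b i : nat := (N <= i %% N + m)%N.
have per (F : nat -> nat) : (\sum_(j <= i < j + N) F (i %% N) = \sum_(0 <= i < N) F i)%N.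
  rewrite (sum_periodic (F := fun i => F (i %% N)%N)); last by move=> i; rewrite modnDr.
  by apply: eq_big_nat => i /andP[_ iN]; rewrite modn_small.
have -> : visits w (iter j shift pd) N = (\sum_(j <= i < j + N) g i)%N.
  have := big_addn (op := addn) (idx := 0%N) 0 (j + N) j xpredT g.
  rewrite add0n addKn => ->; apply: eq_bigr => i _.
  by rewrite -iterD.
have -> : visits w pd N = (\sum_(j <= i < j + N) g (i %% N))%N by rewrite per.
have bm : (\sum_(j <= i < j + N) b i <= m)%N.
  rewrite (per (fun i => (N <= i + m)%N)).
  have [Nm|mN] := leqP N m.
    apply: leq_trans Nm; rewrite -[leqRHS]subn0 -[leqRHS]muln1 -sum_nat_const_nat.
    by apply: leq_sum => i _; exact: leq_b1.
  rewrite (big_cat_nat (n := (N - m)%N))//= ?leq_subr//.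
  rewrite big_nat_cond big1 ?add0n; last first.
    by move=> i /andP[/andP[_ h] _]; apply/eqP; rewrite eqb0 -ltnNge; lia.
  apply: (@leq_trans (\sum_(N - m <= i < N) 1)%N).
    by apply: leq_sum => i _; exact: leq_b1.
  by rewrite sum_nat_const_nat muln1 subKn// ltnW.
have gb i : (g i <= g (i %% N) + b i)%N /\ (g (i %% N) <= g i + b i)%N.
  rewrite /b; case: (leqP N (i %% N + m)%N) => h /=.
    by split; exact: leq_trans (leq_b1 _) (leq_addl _ _).
  by rewrite /g (word_toeplitz (P := P))// addn0.
split; apply: (leq_trans _ (leq_add (leqnn _) bm)); rewrite -big_split /=;
  by apply: leq_sum => i _; have [] := gb i.
Qed.

(** Starting at an even position, the letters of even index are all 0, and the
    letter of index 2t + 1 is the complement of the letter of index t of the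
    desubstituted sequence. *)
Lemma word_even_even m i j :
  (word m (iter i.*2 shift pd) == word m (iter j.*2 shift pd)) =
  (word m./2 (iter i shift pd) == word m./2 (iter j shift pd)).
Proof.
apply/wordP/wordP => e t tm.
  have := e t.*2.+1; rewrite !iter_shiftE !addnS -!doubleD !pd_odd.
  move=> h; apply: negb_inj; apply: h; lia.
rewrite !iter_shiftE; move: tm.
case: (odd t) (odd_double_half t) => /= <- tm.
  rewrite add1n !addnS -!doubleD !pd_odd; congr negb.
  by have := e t./2; rewrite !iter_shiftE; apply; lia.
by rewrite add0n -!doubleD !pd_even.
Qed.

(** Starting at an odd position, it is the letters of even index that carry
    the information, hence the rounding up. *)
Lemma word_odd_odd m i j :
  (word m (iter i.*2.+1 shift pd) == word m (iter j.*2.+1 shift pd)) =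
  (word (uphalf m) (iter i shift pd) == word (uphalf m) (iter j shift pd)).
Proof.
apply/wordP/wordP => e t tm.
  have := e t.*2; rewrite !iter_shiftE !addSn -!doubleD !pd_odd.
  move=> h; apply: negb_inj; apply: h; lia.
rewrite !iter_shiftE; move: tm.
case: (odd t) (odd_double_half t) => /= <- tm.
  by rewrite add1n !addnS !addSn -!doubleD -!doubleS !pd_even.
rewrite add0n !addSn -!doubleD !pd_odd; congr negb.
by have := e t./2; rewrite !iter_shiftE; apply; lia.
Qed.

(** Agreement of the letters of index 0 and 2 forces 1s at the consecutive
    positions j and j + 1, one of which is even and carries a 0. *)
Lemma word_even_odd_neq m i j : (2 < m)%N ->
  (word m (iter i.*2 shift pd) == word m (iter j.*2.+1 shift pd)) = false.
Proof.
move=> m2; apply/negbTE/negP => /wordP e.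
have := e 0%N; have := e 2%N.
rewrite !iter_shiftE !addn0 !addn2 -!doubleS !pd_odd !pd_even.
have m0 : (0 < m)%N by lia.
move=> /(_ m2) h2 /(_ m0) h0.
have : pd j.+1 && pd j by rewrite -[pd j]negbK -h0 -[pd j.+1]negbK -h2.
case: (odd j) (odd_double_half j) => /= <-.
  by rewrite -doubleS pd_even.
by rewrite pd_even andbF.
Qed.

Lemma word2_even_odd i j :
  (word 2 (iter i.*2 shift pd) == word 2 (iter j.*2.+1 shift pd)) = pd i && pd j.
Proof.
apply/wordP/andP => [e|[pi pj] [|[|t]]// _].
- have := e 0%N; have := e 1%N; rewrite !iter_shiftE !addn0 !addn1 -!doubleS.
  by rewrite !pd_odd !pd_even => /(_ isT)/negbFE-> /(_ isT)/esym/negbFE->.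
- by rewrite !iter_shiftE !addn0 pd_odd pd_even pj.
- by rewrite !iter_shiftE !addn1 -doubleS pd_odd pd_even pi.
Qed.

Definition even_odd_pairs m n : nat :=
  (\sum_(0 <= i < n) \sum_(0 <= j < n)
     (word m (iter i.*2 shift pd) == word m (iter j.*2.+1 shift pd)))%N.

Lemma pairs_double m n :
  pairs m pd n.*2 = (pairs m./2 pd n + pairs (uphalf m) pd n +
   2 * even_odd_pairs m n)%N.
Proof.
rewrite {1}/pairs sum_nat_even_odd.
under eq_bigr => i _ do rewrite !sum_nat_even_odd -big_split/=.
under eq_bigr => i _ do under eq_bigr => j _ do
  rewrite word_even_even word_odd_odd.
under eq_bigr => i _ do rewrite !big_split /=.
rewrite !big_split /= -/(pairs _ _ _) -/(pairs _ _ _).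
rewrite -/(even_odd_pairs m n).
set c' := (\sum_(0 <= i < n) \sum_(0 <= j < n) (_ == word m (iter j.*2 shift pd)))%N.
have -> : c' = even_odd_pairs m n.
  by rewrite /c' exchange_big; do 2 apply: eq_bigr => ? _; rewrite eq_sym.
lia.
Qed.

End pd_word.
Arguments even_odd_pairs R m n : clear implicits.

(** * Cylinders and invariant measures *)

Definition cyl (R : realType) m (w : m.-tuple bool) : set (borel_binseq R) :=
  [set x | word m x = w].
Arguments cyl R {m} w.

Section measure.
Context {R : realType}.
Notation pd := (@pd_seq R).
Implicit Types x y : binseq R.

Lemma word_open n (A : set (binseq R)) :
  (forall x y, word n x = word n y -> A x -> A y) -> open A.
Proof.
move=> An; rewrite openE => x Ax; apply/nbhs_ballP; exists (2 ^- n) => /=.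
  by rewrite invr_gt0 exprn_gt0.
move=> y /ltW /rho_le xy; apply: An Ax; apply/eqP/wordP => i; exact: xy.
Qed.

Lemma word_measurable n (A : set (borel_binseq R)) :
  (forall x y : binseq R, word n x = word n y -> A x -> A y) -> measurable A.
Proof. by move=> An; apply: sub_sigma_algebra; exact: word_open An. Qed.

Lemma measurable_pd_subshift : measurable (pd_subshift : set (borel_binseq R)).
Proof.
rewrite -[X in measurable X]setCK; apply: measurableC.
apply: sub_sigma_algebra; apply: closed_openC; exact: closed_closure.
Qed.

Lemma visits_word m (w : m.-tuple bool) x y n :
  word (n + m) x = word (n + m) y -> visits w x n = visits w y n.
Proof.
move=> /eqP/wordP xy; apply: eq_big_nat => i /andP[_ iN]; congr (nat_of_bool (_ == _)).
by apply/eqP/wordP => t tm; rewrite !iter_shiftE xy//; lia.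
Qed.

(** X is the closure of the orbit of omega, and cylinders are open. *)
Lemma subshift_word n x : pd_subshift x ->
  exists j, word n x = word n (iter j shift pd).
Proof.
move=> /(_ [set y : binseq R | word n x = word n y])[].
  have : open [set y : binseq R | word n x = word n y].
    by apply: (@word_open n) => y z yz /= ->.
  by rewrite openE => /(_ x erefl).
by move=> _ [[j _ <-] /= ->]; exists j.
Qed.

Lemma subshift_visits m (w : m.-tuple bool) n x : pd_subshift x ->
  exists j, visits w x n = visits w (iter j shift pd) n.
Proof. by move=> /(subshift_word (n + m))[j xj]; exists j; exact: visits_word. Qed.

Lemma measurable_cyl_shift m (w : m.-tuple bool) i :
  measurable ([set x | word m (iter i shift x) = w] : set (borel_binseq R)).
Proof.
apply: (@word_measurable (i + m)%N) => x y /eqP/wordP xy /= <-.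
by apply/eqP/wordP => t tm; rewrite !iter_shiftE xy//; lia.
Qed.

Lemma measurable_cyl m (w : m.-tuple bool) : measurable (cyl R w).
Proof. exact: (measurable_cyl_shift w 0). Qed.

Lemma mu_cyl_shift (mu : probability (borel_binseq R) R) m (w : m.-tuple bool) i :
  pd_invariant mu ->
  mu [set x | word m (iter i shift x) = w] = mu (cyl R w).
Proof.
move=> [_ inv]; elim: i => [//|i <-].
rewrite -[RHS]inv; last exact: measurable_cyl_shift.
by congr (mu _); apply/funext => x; rewrite /preimage /mkset iterSr.
Qed.

Lemma mu_subshiftI (mu : probability (borel_binseq R) R) (A : set (borel_binseq R)) :
  pd_invariant mu -> measurable A -> mu (A `&` pd_subshift) = mu A.
Proof.
move=> [X1 _] mA; have mX := measurable_pd_subshift.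
rewrite [RHS](measureDI mu mA mX) [X in (X + _)%E](_ : _ = 0%E) ?add0e//.
apply/eqP; rewrite eq_le measure_ge0 andbT.
have <- : mu (~` (pd_subshift : set (borel_binseq R))) = 0%E.
  by rewrite probability_setC// X1 subee.
by apply: le_measure; rewrite ?inE; [exact: measurableD|exact: measurableC|move=> x []].
Qed.

Lemma integral_visits (mu : probability (borel_binseq R) R) m (w : m.-tuple bool) n :
  pd_invariant mu ->
  (\int[mu]_(x in pd_subshift) ((visits w (x : binseq R) n)%:R : R)%:E =
    (n%:R * fine (mu (cyl R w)))%:E)%E.
Proof.
move=> inv; have mX := measurable_pd_subshift.
pose A i : set (borel_binseq R) := [set x | word m (iter i shift x) = w].
have mA i : measurable (A i) by exact: measurable_cyl_shift.
transitivity (\int[mu]_(x in (pd_subshift : set (borel_binseq R)))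
    (\sum_(i <- index_iota 0 n) (\1_(A i) x)%:E)%E)%E.
  apply: eq_integral => x _; rewrite /visits natr_sum -sumEFin; apply: eq_bigr => i _.
  rewrite indicE; congr ((nat_of_bool _)%:R%:E).
  by apply/eqP/idP => [h|/set_mem//]; exact/mem_set.
rewrite ge0_integral_sum//; last first.
  by move=> i; apply/measurable_EFinP; exact: measurable_indic.
rewrite (eq_bigr (fun=> (fine (mu (cyl R w)))%:E)); last first.
  move=> i _; rewrite integral_indic// fineK ?fin_num_measure//; last exact: measurable_cyl.
  by rewrite -(mu_cyl_shift w i inv); exact: mu_subshiftI.
rewrite sumEFin; congr (_%:E).
by rewrite sumr_const_nat subn0 mulr_natl.
Qed.

(** The mean of the number of occurrences over X is n mu[w], by invariance, and
    X has full measure. *)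
Lemma mu_cyl_between (mu : probability (borel_binseq R) R) m (w : m.-tuple bool) n a b :
  pd_invariant mu ->
  (forall x, pd_subshift x -> (a <= visits w (x : binseq R) n <= b)%N) ->
  a%:R <= n%:R * fine (mu (cyl R w)) <= b%:R.
Proof.
move=> inv ab; have mX := measurable_pd_subshift.
(* The number of occurrences depends on the first n + m letters only. *)
have mv : measurable_fun (pd_subshift : set (borel_binseq R))
    (fun x => ((visits w (x : binseq R) n)%:R : R)%:E).
  apply/measurable_EFinP.
  apply: (@measurable_comp _ _ _ _ _ _ setT (fun k : nat => k%:R : R)) => //.
  apply: (@measurable_funS _ _ _ _ setT) => //.
  move=> _ B _; rewrite setTI; apply: (@word_measurable (n + m)%N) => x y xy /=.
  by rewrite (visits_word w xy).
have cX r : (\int[mu]_(x in (pd_subshift : set (borel_binseq R))) cst r%:E x = r%:E)%E.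
  have X1 : mu pd_subshift = 1%E := inv.1.
  rewrite integral_cst//; transitivity (r%:E * 1)%E;
    [congr (_ * _)%E; exact: X1|exact: mule1].
rewrite -!lee_fin -integral_visits// -(cX a%:R) -(cX b%:R).
by apply/andP; split; apply: ge0_le_integral => //= x /ab/andP[? ?];
  rewrite ?lee_fin ?ler_nat.
Qed.

(** By the Toeplitz structure any two windows of length 2^P differ by at most
    2m, hence so does any window from the mean over X. *)
Lemma visits_window_dist (mu : probability (borel_binseq R) R) m (w : m.-tuple bool) P j :
  pd_invariant mu ->
  `|(visits w (iter j shift pd) (2 ^ P))%:R - (2 ^ P)%:R * fine (mu (cyl R w))|
     <= (2 * m)%:R.
Proof.
move=> inv.
have [vj1 vj2] := @visits_block R m w P j.
set v := visits w (iter j shift pd) _ in vj1 vj2 *.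
have : forall x, pd_subshift x -> (v - 2 * m <= visits w (x : binseq R) (2 ^ P) <= v + 2 * m)%N.
  move=> x /(subshift_visits w (2 ^ P))[i ->].
  have [] := @visits_block R m w P i; lia.
move=> /(mu_cyl_between inv)/andP[h1 h2].
rewrite ler_distl lerBlDr -natrD h2 /=.
apply: (@le_trans _ _ ((v - 2 * m)%N%:R + (2 * m)%:R)); last by rewrite lerD2r.
by rewrite -natrD ler_nat; lia.
Qed.

Lemma visits_blocks_dist (mu : probability (borel_binseq R) R) m (w : m.-tuple bool) P t j :
  pd_invariant mu ->
  `|(visits w (iter j shift pd) (t * 2 ^ P))%:R - (t * 2 ^ P)%:R * fine (mu (cyl R w))|
     <= (t * (2 * m))%:R.
Proof.
move=> inv; elim: t j => [|t IH] j.
  by rewrite mul0n /visits big_nil mul0r subrr normr0.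
rewrite (mulSn t (2 ^ P)) (mulSn t (2 * m)) visitsD -iterD.
have := IH (2 ^ P + j)%N; have := visits_window_dist w P j inv.
move=> /lerD h /h{h} h.
by rewrite natrD (natrD _ (2 ^ P)) (natrD _ (2 * m)%N) mulrDl opprD addrACA;
  apply: le_trans (ler_normD _ _) h.
Qed.

(** The orbit segment of length n is cut into blocks of length 2^P, each off by
    at most 2m, and a rest shorter than 2^P. The relative error is at most
    2m / 2^P + 2^P / n: choose P first, then n. *)
Lemma visits_cvg (mu : probability (borel_binseq R) R) m (w : m.-tuple bool) :
  pd_invariant mu ->
  ((visits w pd n)%:R / n%:R : R) @[n --> \oo] --> fine (mu (cyl R w)).
Proof.
move=> inv; apply/cvgrPdist_le => e e0; set f := fine _.
have f01 : 0 <= f <= 1.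
  rewrite fine_ge0//= -lee_fin fineK ?fin_num_measure//; last exact: measurable_cyl.
  by apply: probability_le1; exact: measurable_cyl.
have [P hP] : exists P, (2 * m)%:R / (2 ^ P)%:R <= e / 2.
  exists (Num.bound ((2 * m)%:R / (e / 2))).
  rewrite ler_pdivrMr ?ltr0n ?expn_gt0// mulrC -ler_pdivrMr ?divr_gt0//.
  apply: ltW; apply: lt_trans (archi_boundP _) _; first by rewrite !divr_ge0 // ltW.
  by rewrite ltr_nat ltn_expl.
set N := (2 ^ P)%N in hP.
have N0 : (0 < N)%N by rewrite expn_gt0.
near=> n.
have n0 : (0 < n)%N by near: n; exists 1%N.
have hn : N%:R <= e / 2 * n%:R.
  rewrite mulrC -ler_pdivrMr ?divr_gt0//; near: n; exact: nbhs_infty_ger.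
rewrite distrC.
have -> : (visits w pd n)%:R / n%:R - f = ((visits w pd n)%:R - f * n%:R) / n%:R.
  by rewrite mulrBl mulfK// pnatr_eq0 -lt0n.
rewrite normrM normfV normr_nat ler_pdivrMr ?ltr0n//.
have nE := divn_eq n N; set t := (n %/ N)%N in nE; set r := (n %% N)%N in nE.
have rN : (r < N)%N by rewrite ltn_mod.
have := @visits_blocks_dist mu m w P t 0 inv; rewrite -/f -/N /= => h1.
have : `|(visits w (iter (t * N) shift pd) r)%:R - r%:R * f| <= N%:R.
  have vr := visits_le w (iter (t * N) shift pd) r.
  rewrite ler_distl; apply/andP; split.
    rewrite lerBlDr; apply: (@le_trans _ _ r%:R).
      by rewrite ler_piMr//; case/andP: f01.
    by rewrite -natrD ler_nat; lia.
  rewrite -[leLHS]add0r lerD ?mulr_ge0//; first by case/andP: f01.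
  by rewrite ler_nat; lia.
move: h1 => /lerD h /h{h} h.
have -> : (visits w pd n)%:R - f * n%:R =
  ((visits w pd (t * N))%:R - (t * N)%:R * f) +
  ((visits w (iter (t * N) shift pd) r)%:R - r%:R * f).
  by rewrite {1 2}nE visitsD !natrD; ring.
apply: le_trans (ler_normD _ _) _; apply: le_trans h _.
rewrite [in leRHS](splitr e) mulrDl lerD//.
apply: (@le_trans _ _ ((2 * m)%:R / N%:R * n%:R)); last by rewrite ler_wpM2r.
rewrite mulrAC ler_pdivlMr ?ltr0n// -!natrM ler_nat; nia.
Unshelve. all: end_near.
Qed.

End measure.

(** * The correlation integral as a sum over words *)

Section limits.
Context {R : realType}.
Notation pd := (@pd_seq R).
Implicit Types x y : binseq R.
Implicit Types mu : probability (borel_binseq R) R.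

Lemma cvg_bigsum (I : Type) (s : seq I) (f : I -> nat -> R) (l : I -> R) :
  (forall i, f i n @[n --> \oo] --> l i) ->
  \sum_(i <- s) f i n @[n --> \oo] --> \sum_(i <- s) l i.
Proof.
move=> fl; elim: s => [|i s IH].
  by under eq_fun do rewrite big_nil; rewrite big_nil; exact: cvg_cst.
by under eq_fun do rewrite big_cons; rewrite big_cons; exact: cvgD.
Qed.

Lemma cvg_double (f : nat -> R) (l : R) :
  f n @[n --> \oo] --> l -> f n.*2 @[n --> \oo] --> l.
Proof.
move=> fl; apply: cvg_trans fl => A [N _ NA].
by exists N => // n /= Nn; apply: NA => /=; lia.
Qed.

Lemma cvg_divnn : (n%:R / n%:R : R) @[n --> \oo] --> (1 : R).
Proof.
apply: cvg_near_cst; exists 1%N => // n /= n0.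
by rewrite divff// pnatr_eq0 -lt0n.
Qed.

(** The probability that two independent points of law mu share their first m
    letters. *)
Definition cyl_corr mu m : R :=
  \sum_(w : m.-tuple bool) fine (mu (cyl R w)) ^+ 2.

Lemma pairs_cvg mu m : pd_invariant mu ->
  ((pairs m pd n)%:R / n%:R ^+ 2 : R) @[n --> \oo] --> cyl_corr mu m.
Proof.
move=> inv.
under eq_fun => n.
  rewrite pairs_visits natr_sum mulr_suml.
  under eq_bigr => w _ do rewrite natrX -expr_div_n.
  over.
apply: cvg_bigsum => w.
under eq_fun do rewrite expr2.
by rewrite expr2; apply: cvgM; exact: visits_cvg.
Qed.

(** A distance below 2^(-m+1) is either 0 or a power 2^-n with n >= m. *)
Lemma rho_word (eps : R) x y : 0 < eps ->
  (rho x y <= eps) = (word (m_eps eps) x == word (m_eps eps) y).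
Proof.
move=> eps0; have [eps1|eps1] := leP 1 eps.
  rewrite /m_eps eps1; transitivity true; last by apply/esym/wordP.
  apply: le_trans eps1; have := (rho_le x y 0).2; rewrite expr0 invr1; exact.
have [|m0 /andP[me em]] := (m_epsP (m_eps eps) (_ : 0 < eps < 1)).1 erefl.
  by rewrite eps0.
apply/idP/wordP => [xy|/(rho_le x y _).2 /le_trans]; last exact.
apply/(rho_le x y _).1; have [->|[n rn]] := rho_val x y.
  by rewrite invr_ge0 exprn_ge0.
rewrite rn in xy *; have := le_lt_trans xy em.
rewrite ltf_pV2 ?posrE ?exprn_gt0// ltr_eXn2l ?ltr1n// => h.
by rewrite lef_pV2 ?posrE ?exprn_gt0// ler_eXn2l ?ltr1n//; lia.
Qed.

Lemma corr_sumE (eps : R) x n : 0 < eps ->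
  corr_sum x n eps = (pairs (m_eps eps) x n)%:R / n%:R ^+ 2.
Proof.
move=> eps0; rewrite /corr_sum; congr (_%:R / _).
rewrite -sum1_card big_mkcond /= /pairs big_mkord.
under [RHS]eq_bigr => i _ do rewrite big_mkord.
rewrite pair_bigA /=; apply: eq_bigr => -[i j] _ /=.
by rewrite inE /= rho_word//; case: ifP.
Qed.

(** The set of close pairs is the disjoint union of the squares of the cylinders
    of length m. *)
Lemma corr_intE mu (eps : R) : 0 < eps -> pd_invariant mu ->
  corr_int mu eps = cyl_corr mu (m_eps eps).
Proof.
move=> eps0 inv; rewrite /corr_int; set m := m_eps eps.
pose F (w : m.-tuple bool) := (cyl R w `&` pd_subshift) `*` (cyl R w `&` pd_subshift).
have mC (w : m.-tuple bool) : measurable (cyl R w `&` pd_subshift).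
  by apply: measurableI; [exact: measurable_cyl|exact: measurable_pd_subshift].
rewrite (_ : [set _ | _] = \bigcup_(w in [set` index_enum (m.-tuple bool)]) F w); last first.
  apply/seteqP; split => [[x y] /= [Xx Xy]|[x y] [w _] /= [[xw Xx] [yw Xy]]].
    rewrite rho_word// => /eqP xy; exists (@word R m x); first by rewrite /= mem_index_enum.
    by split; split.
  by split=> //; rewrite rho_word//; rewrite /cyl /= in xw yw; rewrite xw yw.
rewrite measure_fin_bigcup//; last 2 first.
- by move=> w v _ _ [[x y] [[/= [<- _] _] [[<- _] _]]].
- by move=> w _; apply: measurableX.
rewrite -fsbig_seq ?index_enum_uniq//.
rewrite (eq_bigr (fun w => (fine (mu (cyl R w)) ^+ 2)%:E)) ?sumEFin// => w _.
apply: etrans (product_measure1E mu mu (mC w) (mC w)) _.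
have muI : mu (cyl R w `&` pd_subshift) = (fine (mu (cyl R w)))%:E.
  rewrite fineK ?fin_num_measure//; last exact: measurable_cyl.
  by apply: mu_subshiftI => //; exact: measurable_cyl.
by rewrite expr2 EFinM; congr (_ * _)%E; exact: muI.
Qed.

(** * The recurrence and its solution *)

(** This is [pairs_double] divided by (2n)^2, in the limit. *)
Lemma cyl_corr_rec mu m (l : R) : pd_invariant mu ->
  ((even_odd_pairs R m n)%:R / n%:R ^+ 2 : R) @[n --> \oo] --> l ->
  cyl_corr mu m = (cyl_corr mu m./2 + cyl_corr mu (uphalf m)) / 4 + l / 2.
Proof.
move=> inv cl; have h := cvg_double (pairs_cvg (m := m) inv).
apply: (cvg_unique _ h) => //=.
rewrite (_ : (fun n => _) = fun n =>
   ((pairs m./2 pd n)%:R / n%:R ^+ 2 + (pairs (uphalf m) pd n)%:R / n%:R ^+ 2) / 4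
   + (even_odd_pairs R m n)%:R / n%:R ^+ 2 / 2).
  by apply: cvgD; [apply: cvgMl; apply: cvgD; exact: pairs_cvg|exact: cvgMl].
apply/funext => n; rewrite pairs_double -mul2n 2!natrD (natrM _ 2 n) (natrM _ 2) exprMn invfM.
by move: (n%:R ^+ 2 : R)^-1 => u; field.
Qed.

Definition ones n : nat := (\sum_(0 <= i < n) pd i)%N.

Lemma visits_ones n : visits [tuple true] pd n = ones n.
Proof.
apply: eq_bigr => i _; congr nat_of_bool.
have <- : iter i shift pd 0%N = pd i by rewrite iter_shiftE addn0.
apply/eqP/idP => [/(congr1 (fun w => tnth w ord0))|e]; first by rewrite tnth_mktuple => ->.
by apply: eq_from_tnth => k; rewrite (ord1 k) tnth_mktuple.
Qed.

(** Among the letters 2i and 2i + 1, the first is 0 and the second is the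
    complement of the letter i. *)
Lemma ones_double n : (ones n.*2 + ones n = n)%N.
Proof.
rewrite /ones sum_nat_even_odd -big_split /= -[RHS]muln1 -[in RHS](subn0 n) -sum_nat_const_nat.
by apply: eq_bigr => i _; rewrite pd_even pd_odd; case: (pd i).
Qed.

(** The density p exists by [visits_cvg], and [ones_double] gives 2p + p = 1. *)
Lemma ones_cvg mu : pd_invariant mu -> ((ones n)%:R / n%:R : R) @[n --> \oo] --> (1 / 3 : R).
Proof.
move=> inv; have := visits_cvg (w := [tuple true]) inv.
under eq_fun do rewrite visits_ones.
set p := fine _ => h; suff <- : p = 1 / 3 by [].
have : p = (1 - p) / 2.
  apply: (cvg_unique _ (cvg_double h)) => //=.
  rewrite (_ : (fun n => _) = fun n => (n%:R / n%:R - (ones n)%:R / n%:R) / 2 : R).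
    by apply: cvgMl; apply: cvgB => //; exact: cvg_divnn.
  apply/funext => n; have /(congr1 (fun k => k%:R : R)) := ones_double n.
  rewrite natrD => /(canRL (addrK _)) ->.
  rewrite -mul2n natrM invfM; move: (n%:R : R)^-1 => u; by field.
by move=> pE; lra.
Qed.

Lemma cyl_corr0 mu : pd_invariant mu -> cyl_corr mu 0 = 1.
Proof.
move=> inv; apply: (cvg_unique _ (pairs_cvg (m := 0) inv)) => //.
rewrite (_ : (fun n => _) = fun n => (n%:R / n%:R) * (n%:R / n%:R) : R).
  have := cvgM cvg_divnn cvg_divnn; rewrite mulr1; exact.
apply/funext => n; rewrite (_ : pairs 0 pd n = n * n)%N.
  by rewrite natrM expr2 invfM mulrACA.
transitivity (\sum_(0 <= i < n) \sum_(0 <= j < n) 1)%N.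
  apply: eq_bigr => i _; apply: eq_bigr => j _.
  by rewrite (_ : _ == _)//; apply/wordP.
by rewrite !sum_nat_const_nat !subn0 muln1.
Qed.

(** As ceil(1/2) = 1, the recurrence is here an equation for c(1). The letter at
    2i is 0, so 2i and 2j + 1 agree on it iff the letter at j is 1. *)
Lemma cyl_corr1 mu : pd_invariant mu -> cyl_corr mu 1 = 5 / 9.
Proof.
move=> inv; have : cyl_corr mu 1 = (cyl_corr mu 0 + cyl_corr mu 1) / 4 + (1 / 3) / 2.
  apply: (@cyl_corr_rec mu 1) => //.
  rewrite (_ : (fun n => _) = fun n => (n%:R / n%:R) * ((ones n)%:R / n%:R) : R).
    have := cvgM cvg_divnn (ones_cvg inv); rewrite (mul1r (1 / 3)); exact.
  apply/funext => n; rewrite (_ : even_odd_pairs R 1 n = n * ones n)%N.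
    by rewrite natrM expr2 invfM mulrACA.
  transitivity (\sum_(0 <= i < n) ones n)%N; last by rewrite sum_nat_const_nat subn0.
  apply: eq_bigr => i _; apply: eq_bigr => j _; congr nat_of_bool.
  apply/wordP/idP => [/(_ 0%N isT)|pj [|//] _].
    by rewrite !iter_shiftE !addn0 pd_even pd_odd => /esym/negbFE.
  by rewrite !iter_shiftE !addn0 pd_even pd_odd pj.
by rewrite cyl_corr0// => cE; lra.
Qed.

(** Agreement of 2i and 2j + 1 on two letters forces 1s at i and at j; summed over
    all i and j these two conditions are independent. *)
Lemma cyl_corr2 mu : pd_invariant mu -> cyl_corr mu 2 = 1 / 3.
Proof.
move=> inv; have : cyl_corr mu 2 = (cyl_corr mu 1 + cyl_corr mu 1) / 4 + (1 / 3 * (1 / 3)) / 2.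
  apply: (@cyl_corr_rec mu 2) => //.
  rewrite (_ : (fun n => _) = fun n => ((ones n)%:R / n%:R) * ((ones n)%:R / n%:R) : R).
    by apply: cvgM; exact: ones_cvg inv.
  apply/funext => n; rewrite (_ : even_odd_pairs R 2 n = ones n * ones n)%N.
    by rewrite natrM expr2 invfM mulrACA.
  rewrite /ones big_distrlr; apply: eq_bigr => i _; apply: eq_bigr => j _ /=.
  by rewrite word2_even_odd mulnb.
by rewrite cyl_corr1// => cE; lra.
Qed.

Lemma cyl_corr_halves mu m : pd_invariant mu -> (2 < m)%N ->
  cyl_corr mu m = (cyl_corr mu m./2 + cyl_corr mu (uphalf m)) / 4.
Proof.
move=> inv m2; rewrite (@cyl_corr_rec mu m 0) ?mul0r ?addr0//.
rewrite (_ : (fun n => _) = fun=> 0 : R); first exact: cvg_cst.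
apply/funext => n; rewrite /even_odd_pairs big1 ?mul0r// => i _.
by rewrite big1// => j _; rewrite word_even_odd_neq.
Qed.

End limits.

(** With m = 2^(k+1) + q, both halves of m lie in the range for k, at q/2 or at
    (q-1)/2 and (q+1)/2. The endpoint q = 2^(k+1) and the overlap of the two
    formulas at q = 2^k let these two values always be taken from the same
    affine piece. *)
Lemma halving_formula (R : realType) (c : nat -> R) k q :
  c 1%N = 5 / 9 -> c 2%N = 1 / 3 ->
  (forall m, (2 < m)%N -> c m = (c m./2 + c (uphalf m)) / 4) ->
  (q <= 2 ^ k.+1)%N ->
  ((q <= 2 ^ k)%N -> c (2 ^ k.+1 + q)%N = (12 * 2 ^+ k - 4 * q%:R) / (6 * 2 ^+ k) ^+ 2) /\
  ((2 ^ k <= q)%N -> c (2 ^ k.+1 + q)%N = (10 * 2 ^+ k - 2 * q%:R) / (6 * 2 ^+ k) ^+ 2).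
Proof.
move=> c1 c2 crec; have c3 := crec 3 isT; have c4 := crec 4 isT; rewrite /= in c3 c4.
elim: k q => [|k IH] q qk.
  rewrite expr0; move: q qk => [|[|[|//]]] _; split=> // _.
  - by rewrite addn0 c2; lra.
  - by rewrite (_ : 2 ^ 1 + 1 = 3)%N// c3 c1 c2; lra.
  - by rewrite (_ : 2 ^ 1 + 1 = 3)%N// c3 c1 c2; lra.
  - by rewrite (_ : 2 ^ 1 + 2 = 4)%N// c4 c2; lra.
have A0 : (2 ^+ k : R) != 0 by rewrite expf_neq0.
have a0 : (0 < 2 ^ k)%N by rewrite expn_gt0.
have e2 := expnS 2 k.
have -> : (2 ^ k.+2 + q = (2 ^ k.+1).*2 + q)%N by rewrite (expnS 2 k.+1) mul2n.
rewrite crec; last by rewrite expnS; lia.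
rewrite (exprS _ k).
case: (odd q) (odd_double_half q) => qE.
  have -> : ((2 ^ k.+1).*2 + q)./2 = (2 ^ k.+1 + q./2)%N by lia.
  have -> : uphalf ((2 ^ k.+1).*2 + q) = (2 ^ k.+1 + q./2.+1)%N by lia.
  have [h1 h2] : (q./2 <= 2 ^ k.+1 /\ q./2.+1 <= 2 ^ k.+1)%N by rewrite (expnS 2 k.+1) in qk; lia.
  have [l1 r1] := IH _ h1; have [l2 r2] := IH _ h2.
  have -> : q%:R = 2 * q./2%:R + 1 :> R by rewrite -[in LHS]qE -mul2n natrD natrM addrC.
  split => h.
    by rewrite l1 ?l2 -?natr1; [field|lia|lia].
  by rewrite r1 ?r2 -?natr1; [field|lia|lia].
have -> : ((2 ^ k.+1).*2 + q)./2 = (2 ^ k.+1 + q./2)%N by lia.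
have -> : uphalf ((2 ^ k.+1).*2 + q) = (2 ^ k.+1 + q./2)%N by lia.
have h1 : (q./2 <= 2 ^ k.+1)%N by rewrite (expnS 2 k.+1) in qk; lia.
have [l1 r1] := IH _ h1.
have -> : q%:R = 2 * q./2%:R :> R by rewrite -[in LHS]qE -mul2n natrM.
by split => h; [rewrite l1|rewrite r1]; (try by field); lia.
Qed.

Theorem theorem1p4 (R : realType) (mu : probability (borel_binseq R) R)
    (eps : R) :
  0 < eps -> pd_invariant mu ->
  [/\ corr_sum pd_seq n eps @[n --> \oo] --> corr_int mu eps,
      m_eps eps = 0%N -> corr_int mu eps = 1,
      m_eps eps = 1%N -> corr_int mu eps = 5 / 9 &
      forall k q : nat,
        (2 <= m_eps eps)%N -> m_eps eps = (2 ^ k + q)%N -> (q < 2 ^ k)%N ->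
        corr_int mu eps =
          if (q < 2 ^ k.-1)%N
          then (3 * 2 ^+ k.+1 - 4 * q%:R) / (3 * 2 ^+ k) ^+ 2
          else (5 * 2 ^+ k - 2 * q%:R) / (3 * 2 ^+ k) ^+ 2].
Proof.
move=> eps0 inv; rewrite corr_intE//; split.
- by under eq_fun do rewrite corr_sumE//; exact: pairs_cvg.
- by move=> ->; exact: cyl_corr0.
- by move=> ->; exact: cyl_corr1.
move=> k q m2 mE; rewrite mE in m2 *; case: k m2 {mE} => [|k] m2 qk.
  by move: q qk m2 => [].
have [l r] := halving_formula (cyl_corr1 inv) (cyl_corr2 inv)
  (fun m => @cyl_corr_halves _ mu m inv) (ltnW qk).
have A0 : (2 ^+ k : R) != 0 by rewrite expf_neq0.
rewrite /= !exprS; case: ltnP => h.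
  by rewrite l ?(ltnW h)//; field.
by rewrite r//; field.
Qed.
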